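(* Let $a$ be a rational number with $a\in\mathbb{Z}_p^{\times}$ for every prime $p\in\{2,3,5,\dots\}$, and let $b=c$ be a rational number that is not zero or a negative integer. Let $$F(a,b;c;x)=\sum_{n=0}^{\infty}\frac{(a)_n(b)_n}{(c)_n\,n!}x^n$$ be the hypergeometric series. If $x=(x_\infty,x_2,\dots,x_p,\dots)$ is an adele with $|x_v|_v<1$ for all $v\in\{\infty,2,3,\dots,p,\dots\}$, then the sequence $$\mathcal{G}(x)=\big(F(a,b;c;x_\infty),F(a,b;c;x_2),\dots,F(a,b;c;x_p),\dots\big)$$ is an idele, and hence an adele.
   Context: $(a)_n=a(a+1)\cdots(a+n-1)$ is the Pochhammer symbol, with $(a)_0=1$. $|\cdot|_\infty$ is the usual absolute value on $\mathbb{R}$; for a prime $p$, $|\cdot|_p$ is the $p$-adic absolute value on $\mathbb{Q}_p$, $\mathbb{Z}_p$ is the ring of $p$-adic integers and $\mathbb{Z}_p^\times$ its group of units. An adele is an infinite sequence $(a_\infty,a_2,\dots,a_p,\dots)$, indexed by $\infty$ and the primes, with $a_\infty\in\mathbb{R}$, $a_p\in\mathbb{Q}_p$, and $a_p\in\mathbb{Z}_p$ for all but finitely many $p$; adeles form a ring under componentwise operations. An idele is an invertible element of this ring, i.e. a sequence $(\lambda_\infty,\lambda_2,\dots,\lambda_p,\dots)$ with $\lambda_\infty\in\mathbb{R}\setminus\{0\}$, $\lambda_p\in\mathbb{Q}_p\setminus\{0\}$ for all $p$, and $|\lambda_p|_p=1$ for all but finitely many $p$. The component at $v$ of $\mathcal{G}(x)$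 is the sum of the series in $\mathbb{R}$ for $v=\infty$ and in $\mathbb{Q}_p$ for $v=p$. *)

(* Defs.v *)
From HB Require Import structures.
From mathcomp Require Import all_boot all_order all_algebra.
From mathcomp Require Import all_classical all_reals all_analysis.
From mathcomp Require Import generic_quotient ring_quotient.
From mathcomp Require Import zify.

Set Implicit Arguments.
Unset Strict Implicit.
Unset Printing Implicit Defensive.

Import Order.TTheory GRing.Theory Num.Theory.
Import numFieldNormedType.Exports.

Local Open Scope classical_set_scope.
Local Open Scope ring_scope.

Definition prime_nat := {p : nat | prime p}.

Section PadicAbsRat.
Variable p : nat.

(* Junk value 0 at x = 0, where the valuation should be +oo. *)
Definition padic_val (x : rat) : int :=
  (logn p `|numq x|)%:Z - (logn p `|denq x|)%:Z.

Definition padic_abs (x : rat) : rat :=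
  if x == 0 then 0 else p%:Q ^ (- padic_val x).

Hypothesis pp : prime p.

Let p_gt0 : 0 < p%:Q. Proof. by rewrite ltr0n prime_gt0. Qed.
Let p_ge1 : 1 <= p%:Q. Proof. by rewrite ler1n prime_gt0. Qed.

Lemma padic_val_frac (n d : int) : n != 0 -> d != 0 ->
  padic_val (n%:Q / d%:Q) = (logn p `|n|)%:Z - (logn p `|d|)%:Z.
Proof.
move=> n0 d0; set x := n%:Q / d%:Q.
have x0 : x != 0 by rewrite mulf_neq0 ?invr_eq0 ?intr_eq0.
have /eqP : numq x * d = n * denq x.
  apply: (@intr_inj rat); rewrite !intrM numqE /x mulrAC divfK ?intr_eq0//.
move=> /eqP /(congr1 (fun z => logn p `|z|)).
rewrite !abszM !lognM ?absz_gt0 ?numq_eq0 ?denq_neq0// /padic_val => e.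
lia.
Qed.

Lemma padic_abs0 : padic_abs 0 = 0.
Proof. by rewrite /padic_abs eqxx. Qed.

Lemma padic_abs_gt0 x : (0 < padic_abs x) = (x != 0).
Proof.
by rewrite /padic_abs; case: eqVneq => _; rewrite ?ltxx// exprz_gt0.
Qed.

Lemma padic_abs_ge0 x : 0 <= padic_abs x.
Proof.
by have [->|] := eqVneq x 0; rewrite ?padic_abs0// -padic_abs_gt0 => /ltW.
Qed.

Lemma padic_abs_eq0 x : (padic_abs x == 0) = (x == 0).
Proof.
by apply/negb_inj; rewrite -[RHS]padic_abs_gt0 lt0r padic_abs_ge0 andbT.
Qed.

Lemma padic_valM x y : x != 0 -> y != 0 ->
  padic_val (x * y) = padic_val x + padic_val y.
Proof.
move=> x0 y0.
have -> : x * y = (numq x * numq y)%:Q / (denq x * denq y)%:Q.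
  by rewrite !intrM invfM mulrACA !divq_num_den.
rewrite padic_val_frac ?mulf_neq0 ?numq_eq0 ?denq_neq0// !abszM.
rewrite !lognM ?absz_gt0 ?numq_eq0 ?denq_neq0// !PoszD opprD.
by rewrite addrACA.
Qed.

Lemma padic_absM x y : padic_abs (x * y) = padic_abs x * padic_abs y.
Proof.
rewrite /padic_abs mulf_eq0.
have [->|x0] := eqVneq x 0; first by rewrite !mul0r.
have [->|y0] := eqVneq y 0; first by rewrite !mulr0.
by rewrite /= padic_valM// opprD expfzDr// gt_eqF.
Qed.

Lemma padic_abs1 : padic_abs 1 = 1.
Proof. by rewrite /padic_abs oner_eq0 /padic_val logn1 subrr oppr0. Qed.

Lemma padic_absV x : padic_abs x^-1 = (padic_abs x)^-1.
Proof.
have [->|x0] := eqVneq x 0; first by rewrite !(padic_abs0, invr0).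
apply: (@mulfI _ (padic_abs x)); first by rewrite padic_abs_eq0.
by rewrite -padic_absM !mulfV ?padic_abs1// padic_abs_eq0.
Qed.

Lemma padic_absN x : padic_abs (- x) = padic_abs x.
Proof.
by rewrite /padic_abs /padic_val oppr_eq0 numqN denqN abszN.
Qed.

Lemma padic_abs_le1 x : x != 0 -> (padic_abs x <= 1) = (0 <= padic_val x).
Proof.
move=> x0; rewrite /padic_abs (negbTE x0) -(expr0z p%:Q).
by rewrite ler_eXz2l ?oppr_le0// ltr1n prime_gt1.
Qed.

Lemma padic_abs_le1D1 x : padic_abs x <= 1 -> padic_abs (x + 1) <= 1.
Proof.
have [->|x0] := eqVneq x 0; first by rewrite add0r padic_abs1.
have [->|x1] := eqVneq (x + 1) 0; first by rewrite padic_abs0.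
rewrite !padic_abs_le1// => v0.
have ld : logn p `|denq x| = 0%N.
  have := logn_gcd p (n := `|denq x|) (m := `|numq x|).
  rewrite !absz_gt0 numq_eq0 denq_neq0 x0 => /(_ isT isT).
  have /eqP -> := coprime_num_den x; rewrite logn1.
  by move: v0; rewrite /padic_val; lia.
have e : x + 1 = (numq x + denq x)%:Q / (denq x)%:Q.
  by rewrite intrD mulrDl divq_num_den mulfV ?intr_eq0 ?denq_neq0.
rewrite e padic_val_frac ?denq_neq0//; last first.
  by apply: contraNneq x1 => h; rewrite e h mul0r.
by rewrite ld subr0.
Qed.

Lemma padic_absD x y : padic_abs (x + y) <= Num.max (padic_abs x) (padic_abs y).
Proof.
wlog lexy : x y / padic_abs x <= padic_abs y => [hw|].
  case/orP: (le_total (padic_abs x) (padic_abs y)) => /hw//.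
  by rewrite addrC maxC.
rewrite (max_idPr lexy).
have [y0|y0] := eqVneq y 0.
  by move: lexy; rewrite y0 addr0.
have -> : x + y = (x / y + 1) * y by rewrite mulrDl divfK// mul1r.
rewrite padic_absM ler_piMl ?padic_abs_ge0// padic_abs_le1D1//.
by rewrite padic_absM padic_absV ler_pdivrMr ?padic_abs_gt0// mul1r.
Qed.

Lemma padic_absB x y : padic_abs (x - y) = padic_abs (y - x).
Proof. by rewrite -padic_absN opprB. Qed.

End PadicAbsRat.

Section CauchySequences.
Variable p : prime_nat.
Let pp : prime (val p) := valP p.
Local Notation abs := (padic_abs (val p)).
Implicit Types u v : nat -> rat.

Definition padic_cauchy u := forall e : rat, 0 < e ->
  exists N, forall m n, (N <= m)%N -> (N <= n)%N -> abs (u m - u n) < e.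

Definition padic_null u := forall e : rat, 0 < e ->
  exists N, forall n, (N <= n)%N -> abs (u n) < e.

Lemma padic_absD_lt (x y e : rat) : abs x < e -> abs y < e -> abs (x + y) < e.
Proof.
by move=> xe ye; rewrite (le_lt_trans (padic_absD pp _ _))// gt_max xe.
Qed.

Lemma padic_cauchy_bounded u : padic_cauchy u ->
  exists2 M, 0 < M & forall n, abs (u n) < M.
Proof.
move=> /(_ 1 ltr01) [N HN].
pose M := 1 + \sum_(i < N.+1) abs (u i).
have hi i : (i < N.+1)%N -> abs (u i) < M.
  move=> iN; rewrite /M (bigD1 (Ordinal iN))//= addrCA ltrDl.
  by rewrite ltr_pwDl// sumr_ge0// => j _; exact: padic_abs_ge0.
exists M => [|n].
  by rewrite ltr_pwDl// sumr_ge0// => j _; exact: padic_abs_ge0.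
have [/hi//|Nn] := ltnP n N.+1.
rewrite -(subrK (u N) (u n)) padic_absD_lt ?hi//.
rewrite (lt_le_trans (HN _ _ (ltnW Nn) (leqnn N)))// lerDl.
by rewrite sumr_ge0// => j _; exact: padic_abs_ge0.
Qed.

Lemma padic_null_cauchy u : padic_null u -> padic_cauchy u.
Proof.
move=> h e /h[N HN]; exists N => m n Nm Nn.
by rewrite padic_absD_lt ?padic_absN ?HN.
Qed.

Lemma padic_null0 : padic_null 0.
Proof. by move=> e e0; exists 0%N => n _; rewrite padic_abs0. Qed.

Lemma padic_nullB u v : padic_null u -> padic_null v -> padic_null (u - v).
Proof.
move=> hu hv e e0; have [N HN] := hu _ e0; have [M HM] := hv _ e0.
exists (maxn N M) => n; rewrite geq_max => /andP[Nn Mn].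
by rewrite padic_absD_lt ?padic_absN ?HN ?HM.
Qed.

Lemma padic_nullMr u v : padic_cauchy u -> padic_null v -> padic_null (u * v).
Proof.
move=> /padic_cauchy_bounded[M M0 HM] hv e e0.
have [N HN] := hv _ (divr_gt0 e0 M0).
exists N => n Nn; rewrite padic_absM// mulrC.
have := HN _ Nn; rewrite ltr_pdivlMr//; apply: le_lt_trans.
by rewrite ler_wpM2l ?padic_abs_ge0// ltW.
Qed.

Lemma padic_null1 : ~ padic_null 1.
Proof. by move=> /(_ 1 ltr01)[N /(_ _ (leqnn N))]; rewrite padic_abs1. Qed.

Definition is_padic_cauchy u : bool := `[< padic_cauchy u >].

Lemma is_padic_cauchy_subring : subring_closed is_padic_cauchy.
Proof.
split.
- apply/asboolP => e e0; exists 0%N => m n _ _.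
  by rewrite subrr padic_abs0.
- move=> u v /asboolP hu /asboolP hv; apply/asboolP => e e0.
  have [N HN] := hu _ e0; have [M HM] := hv _ e0.
  exists (maxn N M) => m n; rewrite !geq_max => /andP[Nm Mm] /andP[Nn Mn].
  rewrite (_ : (u - v) m - (u - v) n = (u m - u n) + - (v m - v n)).
    by rewrite padic_absD_lt ?padic_absN ?HN ?HM.
  by rewrite /= !opprD opprK addrACA.
- move=> u v /asboolP hu /asboolP hv; apply/asboolP => e e0.
  have [A A0 hA] := padic_cauchy_bounded hu.
  have [B B0 hB] := padic_cauchy_bounded hv.
  have [N HN] := hu _ (divr_gt0 e0 B0).
  have [M HM] := hv _ (divr_gt0 e0 A0).
  exists (maxn N M) => m n; rewrite !geq_max => /andP[Nm Mm] /andP[Nn Mn].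
  have -> : (u * v) m - (u * v) n = (u m - u n) * v m + (v m - v n) * u n.
    by rewrite /= !mulrBl [v m * u n]mulrC [v n * u n]mulrC addrA subrK.
  apply: padic_absD_lt; rewrite padic_absM//.
    have := HN _ _ Nm Nn; rewrite ltr_pdivlMr//; apply: le_lt_trans.
    by rewrite ler_wpM2l ?padic_abs_ge0// ltW.
  have := HM _ _ Mm Mn; rewrite ltr_pdivlMr//; apply: le_lt_trans.
  by rewrite ler_wpM2l ?padic_abs_ge0// ltW.
Qed.

HB.instance Definition _ := GRing.isSubringClosed.Build (nat -> rat)
  is_padic_cauchy is_padic_cauchy_subring.

Record cauchy_seq := CauchySeq {
  cauchy_val :> nat -> rat ;
  cauchy_valP : cauchy_val \in is_padic_cauchy }.

HB.instance Definition _ := [isSub for cauchy_val].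
HB.instance Definition _ := [Choice of cauchy_seq by <:].
HB.instance Definition _ := [SubChoice_isSubComNzRing of cauchy_seq by <:].

Lemma cauchy_seqP (u : cauchy_seq) : padic_cauchy u.
Proof. by have /asboolP := cauchy_valP u. Qed.

Definition is_padic_null (u : cauchy_seq) : bool := `[< padic_null u >].

Lemma is_padic_null_idealr : idealr_closed is_padic_null.
Proof.
split.
- by apply/asboolP; exact: padic_null0.
- by apply/asboolP; exact: padic_null1.
- move=> a u v /asboolP hu /asboolP hv; apply/asboolP.
  have -> : cauchy_val (a * u + v) =
      cauchy_val a * cauchy_val u - (0 - cauchy_val v).
    by rewrite sub0r opprK.
  apply: padic_nullB; first exact: padic_nullMr (cauchy_seqP _) _.
  by apply: padic_nullB => //; exact: padic_null0.
Qed.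

HB.instance Definition _ := isIdealr.Build cauchy_seq
  is_padic_null is_padic_null_idealr.

Definition padic_null_ideal : idealr (cauchy_seq) := is_padic_null.

End CauchySequences.

(* The field of p-adic numbers, as the completion of the rationals for the
   p-adic absolute value: Cauchy sequences modulo null sequences. *)
Definition Qp (p : prime_nat) : Type := {ideal_quot (padic_null_ideal p)}.

HB.instance Definition _ p := GRing.ComNzRing.on (Qp p).

Section QpTheory.
Variable p : prime_nat.
Let pp : prime (val p) := valP p.
Local Notation abs := (padic_abs (val p)).

Definition Qp_class (u : cauchy_seq p) : Qp p :=
  \pi_({ideal_quot (padic_null_ideal p)})%qT u.
Definition Qp_repr (x : Qp p) : cauchy_seq p :=
  repr (x : {ideal_quot (padic_null_ideal p)}).

Lemma Qp_reprK : cancel Qp_repr Qp_class.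
Proof. by move=> x; exact: reprK. Qed.

Lemma Qp_classD : {morph Qp_class : u v / u + v}.
Proof. by move=> u v; exact: raddfD. Qed.
Lemma Qp_classN : {morph Qp_class : u / - u}.
Proof. by move=> u; exact: raddfN. Qed.
Lemma Qp_classM : {morph Qp_class : u v / u * v}.
Proof. by move=> u v; exact: rmorphM. Qed.
Lemma Qp_class0 : Qp_class 0 = 0. Proof. exact: raddf0. Qed.
Lemma Qp_class1 : Qp_class 1 = 1. Proof. exact: rmorph1. Qed.

Lemma Qp_class_eq (u v : cauchy_seq p) :
  Qp_class u = Qp_class v <-> padic_null p (cauchy_val u - cauchy_val v).
Proof.
split=> [/eqP|uv]; first by rewrite -Quotient.idealrBE => /asboolP.
by apply/eqP; rewrite -Quotient.idealrBE; exact/asboolP.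
Qed.

Lemma padic_abs_stable (x y : rat) : abs (x - y) < abs x -> abs y = abs x.
Proof.
move=> xy; apply/eqP; rewrite eq_le; apply/andP; split.
  rewrite -(subrK x y) (le_trans (padic_absD pp _ _))//.
  by rewrite ge_max lexx andbT padic_absB ltW.
rewrite leNgt; apply/negP => yx.
by have := padic_absD_lt xy yx; rewrite subrK ltxx.
Qed.

Lemma padic_cauchy_stable (u : nat -> rat) : padic_cauchy p u ->
  ~ padic_null p u ->
  exists2 N, 0 < abs (u N) & forall n, (N <= n)%N -> abs (u n) = abs (u N).
Proof.
move=> hu /existsNP[e /not_implyP[e0 /forallNP he]].
have [N HN] := hu _ e0.
have /existsNP[n /not_implyP[Nn /negP]] := he N; rewrite -leNgt => en.
exists n => [|m nm]; first exact: lt_le_trans en.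
apply: padic_abs_stable; apply: lt_le_trans en; apply: HN => //.
exact: leq_trans nm.
Qed.

Lemma Qp_mulVx_ex (x : Qp p) : x != 0 -> exists y, y * x = 1.
Proof.
rewrite -(Qp_reprK x); set u := Qp_repr x => x0.
have nu : ~ padic_null p u.
  move=> h; move/eqP: x0; apply; rewrite -Qp_class0; apply/Qp_class_eq.
  by rewrite subr0.
have [N uN0 HN] := padic_cauchy_stable (cauchy_seqP u) nu.
set d := abs (u N) in uN0 HN.
pose v n := if (N <= n)%N then (u n)^-1 else 0.
have u0 n : (N <= n)%N -> u n != 0 by move=> Nn; rewrite -(padic_abs_gt0 pp) HN.
have cv : v \in is_padic_cauchy p.
  apply/asboolP => e e0.
  have [M HM] := cauchy_seqP u (mulr_gt0 e0 (mulr_gt0 uN0 uN0)).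
  exists (maxn N M) => m n; rewrite !geq_max => /andP[Nm Mm] /andP[Nn Mn].
  have -> : v m - v n = (u n - u m) / (u m * u n).
    rewrite /v Nm Nn; apply: (@mulIf _ (u m * u n)).
      by rewrite mulf_neq0 ?u0.
    rewrite divfK ?mulf_neq0 ?u0// mulrBl mulKf ?u0//.
    by rewrite [u m * u n]mulrC mulKf ?u0.
  rewrite padic_absM// padic_absV// padic_absM// !HN//.
  by rewrite ltr_pdivrMr ?mulr_gt0// HM.
exists (Qp_class (CauchySeq cv)); rewrite -Qp_classM -Qp_class1.
apply/Qp_class_eq => e e0; exists N => n Nn.
rewrite [X in abs X](_ : _ = v n * u n - 1)//.
by rewrite /v Nn mulVf ?u0// subrr padic_abs0.
Qed.

Definition Qp_inv (x : Qp p) : Qp p := xget 0 [set y | y * x = 1].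

Lemma Qp_mulVx (x : Qp p) : x != 0 -> Qp_inv x * x = 1.
Proof. by move=> /Qp_mulVx_ex; exact: xgetPex. Qed.

Lemma Qp_inv0 : Qp_inv 0 = 0.
Proof.
by apply: xgetPN => y /eqP; rewrite mulr0 eq_sym oner_eq0.
Qed.

HB.instance Definition _ :=
  GRing.ComNzRing_isField.Build (Qp p) Qp_mulVx Qp_inv0.

(* The values lie in {0} and the integral powers of p, hence are rational; this
   limit of rationals exists because the sequence is null or eventually
   constant. *)
Definition Qp_abs (x : Qp p) : rat :=
  limn ((fun n => abs (Qp_repr x n)) : nat -> rat^o).

Lemma limn_rat_cst (w : nat -> rat^o) (l : rat) :
  (exists N, forall n, (N <= n)%N -> w n = l) -> limn w = l.
Proof.
move=> [N HN]; apply: (@cvg_lim rat^o); first exact: norm_hausdorff.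
by apply: cvg_near_cst; exists N => // n /= /HN.
Qed.

Lemma Qp_abs_class (u : cauchy_seq p) :
  padic_null p u /\ Qp_abs (Qp_class u) = 0 \/
  0 < Qp_abs (Qp_class u) /\
  exists N, forall n, (N <= n)%N -> abs (u n) = Qp_abs (Qp_class u).
Proof.
set r := Qp_repr (Qp_class u).
have ur : padic_null p (cauchy_val u - cauchy_val r).
  by apply/Qp_class_eq; rewrite Qp_reprK.
have [nu|nu] := pselect (padic_null p u); [left|right].
  split=> //; apply: (@cvg_lim rat^o); first exact: norm_hausdorff.
  apply/cvgrPdist_lt => e e0; have [N HN] := padic_nullB nu ur e0.
  exists N => // n /= Nn; rewrite sub0r normrN ger0_norm ?padic_abs_ge0//.
  by have := HN _ Nn; rewrite /= opprB addrC subrK.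
have [N uN0 HN] := padic_cauchy_stable (cauchy_seqP u) nu.
have [M HM] := ur _ uN0.
have -> : Qp_abs (Qp_class u) = abs (u N).
  apply: limn_rat_cst; exists (maxn N M) => n; rewrite geq_max => /andP[Nn Mn].
  by rewrite -(HN n)//; apply: padic_abs_stable; rewrite HN// HM.
by split=> //; exists N.
Qed.

Lemma Qp_abs0 : Qp_abs 0 = 0.
Proof.
rewrite -Qp_class0; have [[]//|[h [N /(_ _ (leqnn N))]]] := Qp_abs_class 0.
by move=> e; move: h; rewrite -e padic_abs0.
Qed.

Lemma Qp_abs_ge0 x : 0 <= Qp_abs x.
Proof.
rewrite -(Qp_reprK x).
by have [[_ ->//]|[/ltW]] := Qp_abs_class (Qp_repr x).
Qed.

Lemma Qp_abs_eq0 x : (Qp_abs x == 0) = (x == 0).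
Proof.
apply/eqP/eqP => [|->]; last exact: Qp_abs0.
rewrite -(Qp_reprK x); have [[nu _] _|[h _] e] := Qp_abs_class (Qp_repr x).
  by rewrite -Qp_class0; apply/Qp_class_eq; rewrite subr0.
by rewrite e ltxx in h.
Qed.

Lemma Qp_absM x y : Qp_abs (x * y) = Qp_abs x * Qp_abs y.
Proof.
have [->|x0] := eqVneq x 0; first by rewrite mul0r Qp_abs0 mul0r.
have [->|y0] := eqVneq y 0; first by rewrite mulr0 Qp_abs0 mulr0.
have xy0 : x * y != 0 by rewrite mulf_neq0.
rewrite -Qp_abs_eq0 in x0; rewrite -Qp_abs_eq0 in y0.
rewrite -Qp_abs_eq0 in xy0; move: x0 y0 xy0.
rewrite -(Qp_reprK x) -(Qp_reprK y) -Qp_classM.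
have [[_ ->]|[_ [N HN]]] := Qp_abs_class (Qp_repr x); first by rewrite eqxx.
have [[_ ->]|[_ [M HM]]] := Qp_abs_class (Qp_repr y); first by rewrite eqxx.
have [[_ ->]|[_ [L HL]]] := Qp_abs_class (Qp_repr x * Qp_repr y).
  by rewrite eqxx.
move=> _ _ _; pose n := maxn N (maxn M L).
rewrite -(HN n) ?leq_maxl// -(HM n) ?leq_max ?leqnn ?orbT//.
by rewrite -(HL n) ?leq_max ?leqnn ?orbT// -padic_absM.
Qed.

Lemma Qp_abs_class_le (u : cauchy_seq p) e : 0 < e -> exists N, forall n,
  (N <= n)%N -> abs (u n) <= Num.max (Qp_abs (Qp_class u)) e.
Proof.
move=> e0; have [[nu _]|[_ [N HN]]] := Qp_abs_class u.
  by have [N HN] := nu _ e0; exists N => n /HN/ltW ue; rewrite le_max ue orbT.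
by exists N => n /HN ->; rewrite le_max lexx.
Qed.

Lemma Qp_absD x y : Qp_abs (x + y) <= Num.max (Qp_abs x) (Qp_abs y).
Proof.
rewrite -(Qp_reprK x) -(Qp_reprK y) -Qp_classD.
have [[_ ->]|[xy0 [L HL]]] := Qp_abs_class (Qp_repr x + Qp_repr y).
  by rewrite le_max Qp_abs_ge0.
set z := Qp_abs _ in xy0 HL *.
have z20 : 0 < z / 2 by rewrite divr_gt0.
have [N HN] := Qp_abs_class_le (Qp_repr x) z20.
have [M HM] := Qp_abs_class_le (Qp_repr y) z20.
pose n := maxn N (maxn M L).
have := padic_absD pp (Qp_repr x n) (Qp_repr y n).
rewrite [X in X <= _](HL n) ?leq_max ?leqnn ?orbT// !le_max.
have z2 : z <= z / 2 = false.
  by apply/negbTE; rewrite -ltNge ltr_pdivrMr// ltr_pMr// ltr1n.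
case/orP => /le_trans h.
  have := h _ (HN n (leq_maxl _ _)).
  by rewrite le_max z2 orbF => ->.
have := h _ (HM n _); rewrite !leq_max leqnn orbT => /(_ isT).
by rewrite le_max z2 orbF => ->; rewrite orbT.
Qed.

Lemma Qp_abs1 : Qp_abs 1 = 1.
Proof.
have h : Qp_abs 1 != 0 by rewrite Qp_abs_eq0 oner_eq0.
by apply: (mulfI h); rewrite -Qp_absM !mulr1.
Qed.

Lemma Qp_absN x : Qp_abs (- x) = Qp_abs x.
Proof.
have : Qp_abs (-1) ^+ 2 = 1 by rewrite expr2 -Qp_absM mulrNN mulr1 Qp_abs1.
move/eqP; rewrite sqrf_eq1 => /orP[|] /eqP h.
  by rewrite -mulN1r Qp_absM h mul1r.
by have := Qp_abs_ge0 (-1); rewrite h oppr_ge0 ler10.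
Qed.

Lemma Qp_abs_ratr (r : rat) : Qp_abs (ratr r) = abs r.
Proof.
have cst_cauchy (s : rat) : (cst s : nat -> rat) \in is_padic_cauchy p.
  by apply/asboolP => e e0; exists 0%N => m n _ _; rewrite subrr padic_abs0.
pose f s := Qp_class (CauchySeq (cst_cauchy s)).
have fB : zmod_morphism f.
  move=> s t; rewrite /f -Qp_classN -Qp_classD.
  by apply/Qp_class_eq => e e0; exists 0%N => n _; rewrite subrr padic_abs0.
have fM : monoid_morphism f.
  split=> [|s t]; rewrite /f -?Qp_class1 -?Qp_classM;
  by apply/Qp_class_eq => e e0; exists 0%N => n _; rewrite subrr padic_abs0.
pose F := GRing.isZmodMorphism.Build _ _ f fB.
pose G := GRing.isMonoidMorphism.Build _ _ f fM.
pose g : {rmorphism rat -> Qp p} := HB.pack f F G.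
rewrite -(fmorph_eq_rat g) /= /f.
have [[nu ->]|[_ [N HN]]] := Qp_abs_class (CauchySeq (cst_cauchy r)).
  apply/esym/eqP; rewrite padic_abs_eq0//; apply: contrapT => /negP.
  rewrite -(padic_abs_gt0 pp) => /nu[N /(_ _ (leqnn N))].
  by rewrite ltxx.
by rewrite -(HN N).
Qed.

Definition Qp_dist (x y : Qp p) : rat := Qp_abs (x - y).

Lemma Qp_distxx x : Qp_dist x x = 0.
Proof. by rewrite /Qp_dist subrr Qp_abs0. Qed.

Lemma Qp_dist_positivity x y : Qp_dist x y = 0 -> x = y.
Proof. by move/eqP; rewrite Qp_abs_eq0 subr_eq0 => /eqP. Qed.

Lemma Qp_dist_sym x y : Qp_dist x y = Qp_dist y x.
Proof. by rewrite /Qp_dist -Qp_absN opprB. Qed.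

Lemma Qp_dist_triangle y x z : Qp_dist x z <= Qp_dist x y + Qp_dist y z.
Proof.
rewrite /Qp_dist -(subrKA y x) (le_trans (Qp_absD _ _))// ge_max.
by rewrite lerDl lerDr !Qp_abs_ge0.
Qed.

HB.instance Definition _ := isPointed.Build (Qp p) 0.
HB.instance Definition _ := isMetric.Build rat (Qp p)
  Qp_distxx Qp_dist_positivity Qp_dist_sym Qp_dist_triangle.

End QpTheory.

Definition padic_int (p : prime_nat) : set (Qp p) := [set x | Qp_abs x <= 1].

Definition padic_units (p : prime_nat) : set (Qp p) :=
  [set x | padic_int x /\ exists2 y, padic_int y & x * y = 1].

Lemma padic_unitsP (p : prime_nat) (x : Qp p) : padic_units x <-> Qp_abs x = 1.
Proof.
split=> [[x1 [y y1 xy]]|x1].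
  apply/eqP; rewrite eq_le x1 leNgt; apply/negP => xlt1.
  have := Qp_abs1 p; rewrite -xy Qp_absM => /eqP; rewrite lt_eqF//.
  by rewrite (le_lt_trans _ xlt1)// ler_piMr ?Qp_abs_ge0.
have x0 : x != 0 by rewrite -Qp_abs_eq0 x1 oner_eq0.
split; first by rewrite /padic_int/= x1.
exists x^-1; last by rewrite mulfV.
by rewrite /padic_int/= -[leLHS]mul1r -x1 -Qp_absM mulfV ?Qp_abs1 ?x1.
Qed.

(* A sequence indexed by the places of the rationals, not yet an adele. *)
Record adelic_seq (R : realType) := AdelicSeq {
  real_comp : R ;
  padic_comp : forall p : prime_nat, Qp p }.

Definition adelic_mul (R : realType) (x y : adelic_seq R) : adelic_seq R :=
  AdelicSeq (real_comp x * real_comp y)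
            (fun p => padic_comp x p * padic_comp y p).

Definition adelic_one (R : realType) : adelic_seq R := AdelicSeq 1 (fun p => 1).

Definition adele (R : realType) : set (adelic_seq R) :=
  [set x | finite_set [set p | ~ padic_int (padic_comp x p)]].

Definition idele (R : realType) : set (adelic_seq R) :=
  [set x | adele x /\ exists2 y, adele y & adelic_mul x y = adelic_one R].

Lemma ideleP (R : realType) (x : adelic_seq R) : idele x <->
  [/\ real_comp x != 0, forall p, padic_comp x p != 0 &
      finite_set [set p | Qp_abs (padic_comp x p) != 1]].
Proof.
split=> [[ax [y ay xy]]|[xoo0 xp0 xfin]].
  have xyoo : real_comp x * real_comp y = 1.
    exact: (congr1 (@real_comp R) xy).
  have xyp p : padic_comp x p * padic_comp y p = 1.
    exact: (congr1 (fun z : adelic_seq R => padic_comp z p) xy).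
  split=> [|p|].
  - by apply: contra_eq_neq xyoo => ->; rewrite mul0r eq_sym oner_neq0.
  - by apply: contra_eq_neq (xyp p) => ->; rewrite mul0r eq_sym oner_neq0.
  - have : finite_set ([set p | ~ padic_int (padic_comp x p)] `|`
                       [set p | ~ padic_int (padic_comp y p)]).
      by rewrite finite_setU.
    apply: sub_finite_set => p /= /eqP xp1; apply: contrapT.
    move=> /not_orP[/contrapT xZ /contrapT yZ]; apply: xp1; apply/padic_unitsP.
    by split=> //; exists (padic_comp y p).
split.
  apply: sub_finite_set xfin => p /= nZ; apply/eqP => x1; apply: nZ.
  by rewrite /padic_int/= x1.
exists (AdelicSeq (real_comp x)^-1 (fun p => (padic_comp x p)^-1)).
  apply: sub_finite_set xfin => p /= nZ.
  apply/eqP => /padic_unitsP[_ [y yZ xy]].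
  apply: nZ; suff -> : (padic_comp x p)^-1 = y by [].
  by apply: (mulfI (xp0 p)); rewrite mulfV ?xp0// xy.
rewrite /adelic_mul/= mulfV//; congr AdelicSeq.
by apply: functional_extensionality_dep => p; rewrite mulfV ?xp0.
Qed.

Definition pochhammer (K : fieldType) (a : K) (n : nat) : K :=
  \prod_(i < n) (a + i%:R).

Definition hypergeo_series (K : fieldType) (a b c x : K) : K ^nat :=
  series (fun n => pochhammer a n * pochhammer b n
                   / (pochhammer c n * n`!%:R) * x ^+ n).

Definition hypergeo_real (R : realType) (a b c : rat) (x : R) : R :=
  limn (hypergeo_series (ratr a) (ratr b) (ratr c) x).

Definition hypergeo_padic (p : prime_nat) (a b c : rat) (x : Qp p) : Qp p :=
  limn (hypergeo_series (ratr a) (ratr b) (ratr c) x).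

Definition hypergeo_adelic (R : realType) (a b c : rat) (x : adelic_seq R) :
    adelic_seq R :=
  AdelicSeq (hypergeo_real a b c (real_comp x))
            (fun p => hypergeo_padic a b c (padic_comp x p)).

(* Main.v *)
(* A rational number that is a unit at every prime is 1 or -1, and for b = c the
   series is the binomial series of (1 - x)^-a. Its sum is thus (1 - x)^-1 or
   1 - x at every place: it is nonzero in the reals, and |x|_p < 1 forces
   |1 - x|_p = 1, so it is a unit at every prime. *)
Require Import Defs.
From mathcomp Require Import all_boot all_order all_algebra.
From mathcomp Require Import all_classical all_reals all_analysis.
Import Order.TTheory GRing.Theory Num.Theory.
Import numFieldNormedType.Exports.

Local Open Scope classical_set_scope.
Local Open Scope ring_scope.

(** Absolute value 1 at [p] says that [p] has the same exponent in numerator and denominator. With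
    this at every prime the two agree up to sign, and being coprime they are both 1 in absolute
    value. *)
Lemma padic_abs1_pm1 (a : rat) :
  (forall p, prime p -> padic_abs p a = 1) -> a = 1 \/ a = -1.
Proof.
move=> ha; have a0 : a != 0.
  have := ha 2%N isT; apply: contra_eq_neq => ->.
  by rewrite padic_abs0 eq_sym oner_eq0.
have nd : `|numq a|%N = `|denq a|%N.
  apply: eqn_from_log; rewrite ?absz_gt0 ?numq_eq0 ?denq_neq0// => p.
  have [pp|np] := boolP (prime p); last by rewrite /logn (negbTE np).
  have := ha p pp; rewrite /padic_abs (negbTE a0).
  (* Writing 1 as the zeroth power of [p] turns the hypothesis into an equality of exponents. *)
  rewrite -(expr0z p%:Q) => /ieexprIz.
  rewrite ltr0n prime_gt0// pnatr_eq1 gtn_eqF ?prime_gt1// => /(_ isT isT) /eqP.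
  by rewrite oppr_eq0 subr_eq0 => /eqP[].
have := coprime_num_den a; rewrite nd /coprime gcdnn => /eqP d1.
have dE : denq a = 1 by rewrite -absz_denq d1.
have aE : a = (numq a)%:~R by rewrite -[LHS]divq_num_den dE divr1.
have : `|numq a|%N == 1%N by rewrite nd d1.
by move: aE; case: (numq a) => [[|[|]]|[|]]// aE _; [left|right].
Qed.

Section HypergeometricSeries.
Variable K : fieldType.
Hypothesis char0 : [pchar K] =i pred0.
Implicit Types b x : K.

Let natr_eq0 n : (n%:R == 0 :> K) = (n == 0)%N.
Proof. exact: (pcharf0P K).1. Qed.

Lemma pochhammer_neq0 b n :
  (forall k, b != - k%:R) -> pochhammer b n != 0.
Proof.
by move=> hb; apply/prodf_neq0 => i _; rewrite addr_eq0 hb.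
Qed.

Lemma pochhammer1 n : pochhammer (1 : K) n = n`!%:R.
Proof.
rewrite /pochhammer; elim: n => [|n IH]; first by rewrite big_ord0.
by rewrite big_ord_recr/= IH nat1r -natrM mulnC.
Qed.

Lemma fact_natr_neq0 n : n`!%:R != 0 :> K.
Proof. by rewrite natr_eq0// -lt0n fact_gt0. Qed.

(** From length 2 on, the product contains the factor -1 + 1. *)
Lemma pochhammerN1 n : pochhammer (-1 : K) n.+2 = 0.
Proof.
by rewrite /pochhammer !big_ord_recl/= addNr mul0r mulr0.
Qed.

Lemma hypergeo_series_diag a b x : (forall k, b != - k%:R) ->
  hypergeo_series a b b x = series (fun n => pochhammer a n / n`!%:R * x ^+ n).
Proof.
move=> hb; apply: eq_fun => n; apply: eq_bigr => k _; congr (_ * _).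
by rewrite invfM mulrA mulfK// pochhammer_neq0.
Qed.

(** Since $(1)_k = k!$, all coefficients are 1 and this is a finite geometric sum. Being purely
    algebraic, the closed form serves both the real and the $p$-adic places. *)
Lemma hypergeo_series1 b x n : (forall k, b != - k%:R) -> x != 1 ->
  hypergeo_series 1 b b x n = (1 - x ^+ n) / (1 - x).
Proof.
move=> hb x1; rewrite hypergeo_series_diag//.
apply: (@mulIf _ (1 - x)); first by rewrite subr_eq0 eq_sym.
rewrite divfK ?subr_eq0 1?eq_sym// -opprB -[in RHS]opprB mulrN; congr (- _).
rewrite subrX1 mulrC /series/= big_mkord; congr (_ * _).
by apply: eq_bigr => i _; rewrite pochhammer1 divff ?fact_natr_neq0// mul1r.
Qed.

(** Only the terms 1 and $-x$ of degree 0 and 1 survive, so the partial sums are constant from index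
    2 on. *)
Lemma hypergeo_seriesN1 b x n : (forall k, b != - k%:R) ->
  hypergeo_series (-1) b b x n.+2 = 1 - x.
Proof.
move=> hb; rewrite hypergeo_series_diag// /series/= big_mkord !big_ord_recl big1.
  rewrite /pochhammer/= !big_ord_recl !big_ord0 /= !fact0 !divr1 expr0 expr1.
  by rewrite addr0 !mulr1 addr0 mulN1r.
by move=> i _; rewrite pochhammerN1 !mul0r.
Qed.

(** Clearing the denominator of [c] turns an equality with $-n$ in [K] into one between integers,
    which characteristic zero allows to be read back in [rat]. *)
Lemma ratr_neqN_nat (c : rat) : (forall n : nat, c != - n%:R) ->
  forall n : nat, ratr c != - n%:R :> K.
Proof.
have inj0 (m : int) : (m%:~R == 0 :> K) = (m == 0).
  by case: m => m; rewrite ?NegzE ?intrN ?oppr_eq0 natr_eq0.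
move=> hc n; apply: contraNneq (hc n) => /eqP.
rewrite /ratr -addr_eq0 => /eqP /(congr1 ( *%R^~ (denq c)%:~R)).
rewrite mulrDl divfK ?inj0 ?denq_neq0// mul0r -[n%:R]/(n%:~R) -intrM -intrD.
move/eqP; rewrite inj0 => /eqP h.
rewrite -[c]divq_num_den -addr_eq0 -(inj_eq (mulIf (_ : (denq c)%:~R != 0))).
  rewrite mulrDl divfK ?intr_eq0 ?denq_neq0// mul0r -[n%:R]/(n%:~R).
  by rewrite -intrM -intrD h.
by rewrite intr_eq0 denq_neq0.
Qed.

End HypergeometricSeries.

(** The embedding of the rationals preserves the absolute value, so a nonzero natural number keeps a
    nonzero absolute value. *)
Lemma pchar_Qp (p : prime_nat) : [pchar Qp p] =i pred0.
Proof.
apply/pcharf0P => n; have := Qp_abs_ratr p n%:R.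
rewrite ratr_nat -Qp_abs_eq0 => ->.
by rewrite padic_abs_eq0 ?pnatr_eq0//; exact: valP.
Qed.

Lemma Qp_absX (p : prime_nat) (x : Qp p) n : Qp_abs (x ^+ n) = Qp_abs x ^+ n.
Proof.
by elim: n => [|n IH]; rewrite ?Qp_abs1// !exprS Qp_absM IH.
Qed.

Lemma Qp_absV (p : prime_nat) (x : Qp p) : Qp_abs x^-1 = (Qp_abs x)^-1.
Proof.
have [->|x0] := eqVneq x 0; first by rewrite !(invr0, Qp_abs0).
have ax0 : Qp_abs x != 0 by rewrite Qp_abs_eq0.
by apply: (mulfI ax0); rewrite -Qp_absM !divff// Qp_abs1.
Qed.

(** The ultrametric inequality is used twice: on $1 - x$ for the upper bound, and on $1 = (1 - x) +
    x$ for the lower one, where $|x|_p < 1$ cannot attain the maximum. *)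
Lemma Qp_abs_1B (p : prime_nat) (x : Qp p) : Qp_abs x < 1 -> Qp_abs (1 - x) = 1.
Proof.
move=> x1; apply/eqP; rewrite eq_le; apply/andP; split.
  by rewrite (le_trans (Qp_absD _ _))// ge_max Qp_abs1 Qp_absN lexx ltW.
have := Qp_absD (1 - x) x; rewrite subrK Qp_abs1 le_max => /orP[//|].
by rewrite leNgt x1.
Qed.

Lemma Qp_abs_neq1 (p : prime_nat) (x : Qp p) : Qp_abs x < 1 -> x != 1.
Proof. by apply: contraTneq => ->; rewrite Qp_abs1 ltxx. Qed.

Lemma hypergeo_series1_cvg_padic (p : prime_nat) (b x : Qp p) :
  (forall k, b != - k%:R) -> Qp_abs x < 1 ->
  hypergeo_series 1 b b x @ \oo --> (1 - x)^-1.
Proof.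
move=> hb x1; apply/cvg_ballP => e e0.
have ax1 : `|Qp_abs x| < 1 by rewrite ger0_norm ?Qp_abs_ge0.
(* The distance from the [n]-th partial sum to the limit is exactly $|x|_p^n$, because $|1 - x|_p =
   1$; its decay is a statement about powers in [rat]. *)
have /cvgrPdist_lt/(_ e e0)[N _ HN] := cvg_expr ax1.
exists N => // n /HN; rewrite sub0r normrN ger0_norm ?exprn_ge0 ?Qp_abs_ge0//.
rewrite ballEmdist/= /mdist/= /Qp_dist hypergeo_series1 ?Qp_abs_neq1//; last first.
  exact: pchar_Qp.
rewrite mulrBl div1r opprB addrC subrK Qp_absM Qp_absX.
by rewrite Qp_absV Qp_abs_1B// invr1 mulr1.
Qed.

Lemma hypergeo_seriesN1_cvg_padic (p : prime_nat) (b x : Qp p) :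
  (forall k, b != - k%:R) -> hypergeo_series (-1) b b x @ \oo --> 1 - x.
Proof.
move=> hb; apply: cvg_near_cst; exists 2%N => // -[|[|n]]// _.
exact: hypergeo_seriesN1.
Qed.

Lemma hypergeo_series1_cvg_real (R : realType) (b x : R) :
  (forall k, b != - k%:R) -> `|x| < 1 ->
  hypergeo_series 1 b b x @ \oo --> (1 - x)^-1.
Proof.
move=> hb x1; have xN1 : x != 1.
  by apply: contraTneq x1 => ->; rewrite normr1 ltxx.
rewrite -[X in _ --> X]mul1r.
suff -> : hypergeo_series 1 b b x = series (geometric 1 x).
  exact: cvg_geometric_series.
rewrite geometric_seriesE//; apply/funext => n.
by rewrite hypergeo_series1 /= ?mul1r//; exact: pchar_num.
Qed.

Lemma hypergeo_seriesN1_cvg_real (R : realType) (b x : R) :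
  (forall k, b != - k%:R) -> hypergeo_series (-1) b b x @ \oo --> 1 - x.
Proof.
move=> hb; apply: cvg_near_cst; exists 2%N => // -[|[|n]]// _.
exact: hypergeo_seriesN1.
Qed.

(** As [limn] gives a default value on divergent sequences, the two convergence clauses certify that
    the components are genuine sums. *)
Theorem theorem4p12 (R : realType) (a b c : rat)
    (ha : forall p : prime_nat, padic_units (ratr a : Qp p))
    (hbc : b = c)
    (hc : forall n : nat, c != - n%:R)
    (x : adelic_seq R)
    (hx : adele x)
    (hx_real : `|real_comp x| < 1)
    (hx_padic : forall p : prime_nat, Qp_abs (padic_comp x p) < 1) :
  [/\ cvgn (hypergeo_series (ratr a) (ratr b) (ratr c) (real_comp x)),
      forall p : prime_nat,
        cvgn (hypergeo_series (ratr a) (ratr b) (ratr c) (padic_comp x p)),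
      idele (hypergeo_adelic a b c x)
    & adele (hypergeo_adelic a b c x)].
Proof.
subst b.
have cR k : ratr c != - k%:R :> R by apply: ratr_neqN_nat hc k; exact: pchar_num.
have cQ (p : prime_nat) k : ratr c != - k%:R :> Qp p.
  by apply: ratr_neqN_nat hc k; exact: pchar_Qp.
have a1 : a = 1 \/ a = -1.
  apply: padic_abs1_pm1 => p pp.
  by have /padic_unitsP := ha (exist _ p pp); rewrite Qp_abs_ratr.
have [lR lR0 cvgR] : exists2 l : R, l != 0 &
    hypergeo_series (ratr a) (ratr c) (ratr c) (real_comp x) @ \oo --> l.
  have x1 : 1 - real_comp x != 0.
    rewrite subr_eq0 eq_sym.
    by apply: contraTneq hx_real => ->; rewrite normr1 ltxx.
  case: a1 => ->.
    exists (1 - real_comp x)^-1; first by rewrite invr_eq0.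
    by rewrite (ratr_nat _ 1); exact: hypergeo_series1_cvg_real.
  exists (1 - real_comp x) => //.
  by rewrite (ratr_int _ (-1)); exact: hypergeo_seriesN1_cvg_real.
(* Only the absolute value of the limit is recorded, so that the cases $a = 1$ and $a = -1$ need not
   be separated afterwards. *)
have cvgQ (p : prime_nat) : exists2 l : Qp p, Qp_abs l = 1 &
    hypergeo_series (ratr a) (ratr c) (ratr c) (padic_comp x p) @ \oo --> l.
  case: a1 => ->.
    exists (1 - padic_comp x p)^-1; first by rewrite Qp_absV Qp_abs_1B// invr1.
    by rewrite (ratr_nat _ 1); exact: hypergeo_series1_cvg_padic.
  exists (1 - padic_comp x p); first exact: Qp_abs_1B.
  by rewrite (ratr_int _ (-1)); exact: hypergeo_seriesN1_cvg_padic.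
have absQ (p : prime_nat) : Qp_abs (hypergeo_padic a c c (padic_comp x p)) = 1.
  have [l l1 cvgl] := cvgQ p.
  by rewrite /hypergeo_padic (cvg_lim _ cvgl)//; exact: metric_hausdorff.
have hidele : idele (hypergeo_adelic a c c x).
  apply/ideleP; split => [|p|] /=.
  - by rewrite /hypergeo_real (cvg_lim _ cvgR)//; exact: Rhausdorff.
  - by rewrite -Qp_abs_eq0 absQ oner_eq0.
  (* Every $p$-adic component is a unit, so the exceptional set is even empty. *)
  - rewrite (_ : mkset _ = set0)//.
    by apply/seteqP; split => // p /=; rewrite absQ eqxx.
split=> //; last by case: hidele.
- exact: cvgP cvgR.
- by move=> p; have [l _ cvgl] := cvgQ p; exact: cvgP cvgl.
Qed.
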